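(* Let $b,c$ be independent indeterminates over $\mathbb{Q}$, and let $(u_n)_{n\ge -1}$ be the sequence of elements of $\mathbb{Q}[b,c]$ defined by $u_{-1}=0$, $u_0=1$ and the recursion \[ n u_n - 2(2n-1)\big(n(n-1)-b\big)u_{n-1} + 4c(n-1)u_{n-2} = 0 \qquad\text{for } n=1,2,3,\dots. \] Then $u_n\in\mathbb{Z}[b,c]$ for all $n\ge 0$. *)

(* Defs.v *)
From HB Require Import structures.
From mathcomp Require Export all_boot all_order all_algebra.
From mathcomp.multinomials Require Export mpoly.

Set Implicit Arguments.
Unset Strict Implicit.
Unset Printing Implicit Defensive.

Local Open Scope ring_scope.

Definition b : {mpoly rat[2]} := 'X_(ord0 : 'I_2).
Definition c : {mpoly rat[2]} := 'X_(ord_max : 'I_2).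

(* Main.v *)
Require Import Defs.
From mathcomp Require Import ring zify.

Set Implicit Arguments.
Unset Strict Implicit.
Unset Printing Implicit Defensive.

Import GRing.Theory.

Local Open Scope ring_scope.

(* The recursion is a third-order differential equation for U = sum u_n x^n,
   which is the symmetric square of a (Mathieu) second-order equation.  As such
   it has a quadratic first integral: with D = x d/dx,
     U^2 + 4 x ((b + c x) U^2 + (D U)^2 - U (D U) - 2 U (D^2 U)) = 1.
   Comparing coefficients of x^(n+1) gives
     2 u_(n+1) + sum_(0 < i <= n) u_i u_(n+1-i) = 4 (an integral expression),
   so by strong induction every u_n with n > 0 is twice an element of Z[b,c]. *)

Lemma sum_antidiag_swap (R : nmodType) (f : nat -> nat -> R) n :
  \sum_(i < n) f i (n.-1 - i)%N = \sum_(i < n) f (n.-1 - i)%N i.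
Proof.
rewrite (reindex_inj rev_ord_inj) /=; apply: eq_bigr => i _.
by have lt_in := ltn_ord i; congr f; lia.
Qed.

Lemma sum_antidiag_shift (R : nmodType) (f : nat -> nat -> R) n :
    (forall i, f i 0%N = 0) ->
  \sum_(i < n.+1) f i (n - i)%N = \sum_(i < n) f i (n.-1 - i).+1.
Proof.
move=> f0; rewrite big_ord_recr /= subnn f0 addr0; apply: eq_bigr => i _.
by have lt_in := ltn_ord i; congr f; lia.
Qed.

Section QuadraticFirstIntegral.

Variables (R : comNzRingType) (b c : R) (v : nat -> R).

Hypothesis v_rec : forall n, n.+1%:R * v n.+1 =
  2 * (2 * n%:R + 1) * (n.+1%:R * n%:R - b) * v n - 4 * c * n%:R * v n.-1.

(** The factor [n.+1%:R] comes from applying D to the first integral: it is D of that identity which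
    follows from the recursion, with no division in [R]. *)
Lemma first_integral n : n.+1%:R *
  (\sum_(i < n.+2) v i * v (n.+1 - i)%N
   + 4 * \sum_(i < n.+1) v i * v (n - i)%N *
       (b + i%:R * (n - i)%:R - (n - i)%:R - 2 * (n - i)%:R ^+ 2)
   + 4 * c * \sum_(i < n) v i * v (n.-1 - i)%N) = 0.
Proof.
pose V i j := v i * (j%:R * v j).
(* D(U^2) = 2 U (D U): split m as i + (m - i) and swap the two indices in one half. [sumC] splits n
   + 1 as (i + 1) + (n - i) likewise. *)
have sumV m : m%:R * (\sum_(i < m.+1) v i * v (m - i)%N) =
    2 * \sum_(i < m.+1) V i (m - i)%N.
  rewrite mulr_natl -[2]/(1 + 1) mulrDl mul1r {2}(sum_antidiag_swap V m.+1).
  rewrite -big_split -mulr_natl mulr_sumr; apply: eq_bigr => i _ /=.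
  have /subnKC {1}<- : (i <= m)%N by have := ltn_ord i.
  by rewrite /V natrD; ring.
have sumW : \sum_(i < n.+1) v i * ((n - i)%:R * v (n - i).-1) =
    \sum_(i < n) v i * ((n.-1 - i).+1%:R * v (n.-1 - i)%N).
  by rewrite (sum_antidiag_shift (f := fun i j => v i * (j%:R * v j.-1))) // =>
    i; rewrite mul0r mulr0.
have sumC : n.+1%:R * (\sum_(i < n) v i * v (n.-1 - i)%N) =
    2 * (\sum_(i < n) v i * ((n.-1 - i).+1%:R * v (n.-1 - i)%N)).
  pose f i j := v i * (j.+1%:R * v j).
  rewrite -[2]/(1 + 1) mulrDl mul1r {2}(sum_antidiag_swap f n).
  rewrite -big_split mulr_sumr; apply: eq_bigr => i _ /=.
  have {1}-> : n.+1 = (i.+1 + (n.-1 - i).+1)%N by have := ltn_ord i; lia.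
  by rewrite /f natrD; ring.
(* Without its zero term j = 0, the sum involves only (j + 1) v_(j+1), which the recursion
   rewrites. *)
rewrite !mulrDr sumV (sum_antidiag_shift (f := V)) /=; last first.
  by move=> i; rewrite /V mul0r mulr0.
(* By the recursion, up to the other two terms of the identity, the sum of
   [V i (n - i).+1] has summand [2 (k i j - k j i)], which is antisymmetric. *)
pose k i j := v i * v j * (i%:R ^+ 2 * j%:R + b * i%:R).
have sumB : \sum_(i < n.+1) V i (n - i).+1 =
    2 * (\sum_(i < n.+1) k i (n - i)%N - \sum_(i < n.+1) k (n - i)%N i)
    - 2 * (n.+1%:R * \sum_(i < n.+1) v i * v (n - i)%N *
       (b + i%:R * (n - i)%:R - (n - i)%:R - 2 * (n - i)%:R ^+ 2))
    - 4 * c * \sum_(i < n.+1) v i * ((n - i)%:R * v (n - i).-1).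
  rewrite -sumrB !mulr_sumr -!sumrB; apply: eq_bigr => i _.
  rewrite /V v_rec /k.
  have -> : n.+1%:R = i%:R + (n - i)%:R + 1 :> R.
    by rewrite -natrD natr1 subnKC // -ltnS.
  by rewrite -natr1; ring.
rewrite sumB (sum_antidiag_swap k n.+1) subrr sumW [_ * (4 * c * _)]mulrCA sumC.
by ring.
Qed.

End QuadraticFirstIntegral.

(** [S] need not be closed under division; characteristic 0 allows n + 1 and 2 to be cancelled in
    the domain [R]. *)
Lemma rec_integral (R : idomainType) (S : subringClosed R) (b c : R)
    (v : nat -> R) :
    [pchar R] =i pred0 -> b \in S -> c \in S -> v 0%N = 1 ->
    (forall n, n.+1%:R * v n.+1 =
      2 * (2 * n%:R + 1) * (n.+1%:R * n%:R - b) * v n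
      - 4 * c * n%:R * v n.-1) ->
  forall n, v n \in S.
Proof.
move=> /pcharf0P R0 Sb Sc v0 v_rec.
suff half n : exists2 w, w \in S & v n.+1 = 2 * w.
  case=> [|n]; first by rewrite v0 rpred1.
  by have [w Sw ->] := half n; rewrite rpredM ?rpred_nat.
elim/ltn_ind: n => n IHn.
have Sv i : (i <= n)%N -> v i \in S.
  case: i => [|i] lt_in; first by rewrite v0 rpred1.
  by have [w Sw ->] := IHn i lt_in; rewrite rpredM ?rpred_nat.
have [s Ss sE] : exists2 s, s \in S &
    \sum_(i < n) v i.+1 * v (n - i)%N = 4 * s.
  (* Both indices lie between 1 and n, so each factor supplies a 2. *)
  have /fin_all_exists2[w Sw wE] (i : 'I_n) :
      exists2 w, w \in S & v i.+1 * v (n - i)%N = 4 * w.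
    have lt_in := ltn_ord i; have [w1 Sw1 ->] := IHn i lt_in.
    have -> : (n - i = (n - i.+1).+1)%N by lia.
    have /IHn[w2 Sw2 ->] : (n - i.+1 < n)%N by lia.
    by exists (w1 * w2); [rewrite rpredM | ring].
  exists (\sum_i w i); first by rewrite rpred_sum.
  by rewrite mulr_sumr; apply: eq_bigr.
have /eqP := first_integral v_rec n.
(* The two end terms of the first sum are both [v n.+1], since v_0 = 1. *)
rewrite mulf_eq0 R0 /= big_ord_recl big_ord_recr /= subnn subn0 v0 mul1r mulr1.
under eq_bigr do rewrite /bump leq0n add1n subSS.
rewrite sE; set B := \sum_(i < _) _; set C := \sum_(i < _) _ => /eqP eq0.
have SB : B \in S.
  apply: rpred_sum => i _; have lt_in := ltn_ord i.
  rewrite rpredM ?rpredB ?rpredD ?rpredM ?rpredX ?rpred_nat ?Sv //.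
  exact: leq_subr.
have SC : C \in S.
  by apply: rpred_sum => i _; have lt_in := ltn_ord i; rewrite rpredM ?Sv //; lia.
(* The identity now reads 2 v_(n+1) + 4 s + 4 B + 4 c C = 0. *)
exists (- (s + B + c * C)); first by rewrite rpredN !rpredD ?rpredM.
have nz2 : (2 : R) != 0 by rewrite R0.
by apply: (mulfI nz2); apply/eqP; rewrite -subr_eq0 -eq0; apply/eqP; ring.
Qed.

Theorem theorem1 (u : int -> {mpoly rat[2]})
  (u_m1 : u (-1) = 0)
  (u_0 : u 0 = 1)
  (u_rec : forall n : int, 1 <= n ->
     n%:~R * u n
     - 2 * (2 * n - 1)%:~R * ((n * (n - 1))%:~R - b) * u (n - 1)
     + 4 * c * (n - 1)%:~R * u (n - 2) = 0) :
  forall n : int, 0 <= n -> u n \is a mpolyOver 2 Num.int.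
Proof.
case=> // n _.
pose S := GRing.SubringClosed.clone {mpoly rat[2]}
  (mpolyOver_pred Num.int_num_subdef) _.
apply: (@rec_integral _ S b c (fun n => u n%:Z)) => //.
- apply/pcharf0P => m.
  by rewrite -mpolyC_nat mpolyC_eq0 Num.Theory.pnatr_eq0.
- exact: mpolyOverX.
- exact: mpolyOverX.
move=> {}n; have := u_rec n.+1 isT.
have -> : n.+1%:Z - 1 = n by lia.
have -> : 2 * n.+1%:Z - 1 = 2 * n%:Z + 1 by lia.
rewrite rmorphM rmorphD rmorphM /= -!pmulrn.
(* At n = 0 the last term has [u (-1)] in [u_rec] but [u 0] in the goal, as [0.-1] is 0; both have
   coefficient 0. *)
case: n => [|n].
  by rewrite !(mulr0, mul0r) addr0 subr0 => /eqP; rewrite subr_eq0 => /eqP ->.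
have -> : n.+2%:Z - 2 = n by lia.
by move=> /eqP; rewrite addr_eq0 subr_eq => /eqP ->; rewrite addrC.
Qed.
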